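(* Let $G$ be a locally finite, connected graph and $p\colon \hat G \to G$ a normal covering with $\hat G$ connected. If $\hat G$ is chordal, then $\hat G$ admits a $\Gamma(p)$-canonical tree-decomposition into its maximal cliques.
   Context: Graphs are simple; a graph is locally finite if all its vertices have finite degree, and chordal if every cycle of length at least four has a chord. A clique is a vertex set inducing a complete subgraph; a maximal clique is an inclusion-maximal one. A covering of a graph $G$ is a surjective graph homomorphism $p:\hat G\to G$ that restricts, for every vertex $\hat v$ of $\hat G$, to a bijection from the edges incident to $\hat v$ to the edges incident to $p(\hat v)$. A deck transformation of $p$ is an automorphism $\gamma$ of $\hat G$ with $p=p\circ\gamma$; the group of deck transformations is $\Gamma(p)$. The covering $p$ is normal if $\Gamma(p)$ acts transitively on each fibre $p^{-1}(v)$, $v\in V(G)$. A tree-decomposition of a graph $G$ is a pair $(T,\mathcal V)$ of a tree $T$ and a family $\mathcal V=(V_t)_{t\in V(T)}$ of vertex sets (bags) of $G$ with $G=\bigcup_t G[V_t]$ and such that for every vertex $v$ of $G$ the subgraph of $T$ induced on $\{t:v\in V_t\}$ is connected. For a subgroup $\Gamma$ of $\mathrm{Aut}(G)$, it is $\Gamma$-canonical if there is an action of $\Gamma$ on $T$ with $V_{\phi\cdot t}=\phi(V_t)$ for all $t\in V(T)$ and $\phi\in\Gamma$. It is into the maximal cliques of $G$ if $t\mapsto V_t$ is a bijection from $V(T)$ to the set of maximal cliques of $G$. *)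

(* Defs.v *)
From mathcomp Require Import all_boot.
From mathcomp Require Import boolp classical_sets functions cardinality.

Set Implicit Arguments.
Unset Strict Implicit.
Unset Printing Implicit Defensive.

Local Open Scope classical_set_scope.

(* Possibly infinite simple graphs. *)
Record sgraph := SGraph {
  vertex :> Type;
  adj : vertex -> vertex -> Prop;
  adj_sym : forall x y, adj x y -> adj y x;
  adj_irr : forall x, ~ adj x x
}.

Section Graphs.
Variable G : sgraph.
Implicit Types (x y v : G) (e K L : set G).

Definition is_edge e := exists x y, adj x y /\ e = [set x; y].

Definition edges_at v : set (set G) := [set e | is_edge e /\ e v].

(* Since [G] is simple, the degree of [v] is its number of neighbours. *)
Definition locally_finite := forall v, finite_set [set w | adj v w].

Fixpoint walk x (s : seq G) : Prop :=
  if s is y :: s' then adj x y /\ walk y s' else True.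

(* The null graph is not connected. *)
Definition connected :=
  (exists x : G, True) /\
  forall x y, exists s : seq G, walk x s /\ last x s = y.

(* [ordS] is the cyclic successor on ['I_n]. *)
Definition is_cycle n (c : 'I_n -> G) :=
  [/\ 3 <= n, injective c & forall i, adj (c i) (c (ordS i))].

Definition has_chord n (c : 'I_n -> G) :=
  exists i j, [/\ adj (c i) (c j), j != ordS i & i != ordS j].

Definition chordal :=
  forall n (c : 'I_n -> G), 4 <= n -> is_cycle c -> has_chord c.

Definition is_tree := connected /\ forall n (c : 'I_n -> G), ~ is_cycle c.

Definition clique K := forall x y, K x -> K y -> x <> y -> adj x y.

Definition maximal_clique K :=
  clique K /\ forall L, clique L -> K `<=` L -> L = K.

Definition automorphism (f : G -> G) :=
  bijective f /\ forall x y, adj (f x) (f y) <-> adj x y.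

Definition induced_adj (A : set G) (x y : {v : G | A v}) :=
  adj (proj1_sig x) (proj1_sig y).

Lemma induced_sym (A : set G) (x y : {v : G | A v}) :
  induced_adj x y -> induced_adj y x.
Proof. exact: adj_sym. Qed.

Lemma induced_irr (A : set G) (x : {v : G | A v}) : ~ induced_adj x x.
Proof. exact: adj_irr. Qed.

Definition induced (A : set G) : sgraph :=
  SGraph (@induced_sym A) (@induced_irr A).

End Graphs.

Section Coverings.
Variables (H G : sgraph) (p : H -> G).

(* [p @` e] is the image of the edge [e], edges being two-element sets. *)
Definition covering :=
  [/\ forall y : G, exists x : H, p x = y,
      forall x y : H, adj x y -> adj (p x) (p y)
    & forall v : H, set_bij (edges_at v) (edges_at (p v)) (fun e => p @` e)].

Definition deck : set (H -> H) :=
  [set f | automorphism f /\ forall x, p (f x) = p x].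

Definition normal_covering :=
  covering /\
  forall x y : H, p x = p y -> exists f, deck f /\ f x = y.

End Coverings.

Section TreeDecompositions.
Variables (G T : sgraph) (bag : T -> set G).

Definition tree_decomposition :=
  [/\ is_tree T,
      forall v : G, exists t, bag t v,
      forall x y : G, adj x y -> exists t, bag t x /\ bag t y
    & forall v : G, connected (induced [set t | bag t v])].

(* [Gam] is to be a subgroup of the automorphism group of [G] (under
   composition), and [act] an action of [Gam] on [T] by automorphisms; the
   values of [act] outside [Gam] are irrelevant. *)
Definition canonical_decomposition (Gam : set (G -> G)) :=
  exists act : (G -> G) -> T -> T,
    [/\ forall f, Gam f -> automorphism (act f),
        forall t, act id t = t,
        forall f g, Gam f -> Gam g -> forall t, act (f \o g) t = act f (act g t)
      & forall f, Gam f -> forall t, bag (act f t) = f @` bag t].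

Definition into_maximal_cliques :=
  set_bij [set: T] (@maximal_clique G) bag.

End TreeDecompositions.

(* Main.v *)
(* The decomposition tree is a maximum weight spanning tree of the graph of
   maximal cliques, built separately for each nonempty clique S: group the
   maximal cliques containing S by connectedness outside S, and link the groups
   by a star whose edges all have intersection S.  Choices for different S do
   not interact.  A deck transformation preserving a nonempty clique fixes it
   pointwise, since a clique meets each fibre at most once, and hence is the
   identity; so the stars can be chosen equivariantly.  Chordality
   makes an induced path outside S between two common neighbours of S stay in
   the common neighbourhood of S, whence, by descending induction on S, the
   maximal cliques containing S are connected in the tree.  In a cycle of the
   tree, an edge with inclusion-minimal intersection S would be bypassed outside
   S, against the choice of the star of S. *)
Require Import Defs.
From mathcomp Require Import all_boot zify.
From mathcomp Require Import boolp classical_sets functions cardinality.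
From Stdlib Require Import Relation_Operators Operators_Properties.

Set Implicit Arguments.
Unset Strict Implicit.
Unset Printing Implicit Defensive.

Local Open Scope classical_set_scope.

(** The chosen element depends only on [x0] and the set [P], not on a proof that [P] is inhabited,
    so equal sets give equal choices. *)
Definition eps (T : Type) (x0 : T) (P : set T) : T :=
  if pselect (exists x, P x) is left e then projT1 (cid e) else x0.

Lemma epsP (T : Type) (x0 : T) (P : set T) : (exists x, P x) -> P (eps x0 P).
Proof. by rewrite /eps => e; case: pselect => // e'; case: cid. Qed.

Lemma image_can (T : Type) (f g : T -> T) (A : set T) :
  cancel g f -> f @` (g @` A) = A.
Proof.
move=> gK; apply/seteqP; split=> [x [_ [y Ay <-] <-]|x Ax].
  by rewrite gK.
by exists (g x); [exists x | exact: gK].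
Qed.

(** * Walks inside a vertex set and induced paths *)

Section Reachability.
Variable G : sgraph.
Implicit Types (A B : set G) (x y z : G).

(** By reflexivity [reach A x x] holds even outside [A]; hence the hypothesis [A x] wherever a path
    inside [A] is extracted. *)
Definition reach A : G -> G -> Prop :=
  clos_refl_trans G (fun x y => [/\ A x, A y & adj x y]).

Lemma reach_step A x y : A x -> A y -> adj x y -> reach A x y.
Proof. by move=> *; apply: rt_step. Qed.

Lemma reach_trans A y x z : reach A x y -> reach A y z -> reach A x z.
Proof. exact: rt_trans. Qed.

Lemma reach_sym A x y : reach A x y -> reach A y x.
Proof.
elim=> [{}x {}y [Ax Ay xy]|{}x|{}x z {}y _ zx _ yz].
- by apply: reach_step => //; apply: adj_sym.
- exact: rt_refl.
- exact: reach_trans zx.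
Qed.

Lemma reach_sub A B x y : A `<=` B -> reach A x y -> reach B x y.
Proof.
move=> AB; elim=> [{}x {}y [Ax Ay xy]|{}x|{}x z {}y _ zx _ yz].
- by apply: reach_step => //; apply: AB.
- exact: rt_refl.
- exact: reach_trans yz.
Qed.

Lemma connected_induced A :
  (exists x, A x) -> (forall x y, A x -> A y -> reach A x y) ->
  connected (induced A).
Proof.
move=> [x0 Ax0] reachA; split; first by exists (exist _ x0 Ax0).
move=> [x Ax] [y Ay]; have xy := clos_rt_rt1n _ _ _ _ (reachA x y Ax Ay).
elim: xy Ax Ay => {x y} [x|x z y [_ Az xz] _ IH] Ax Ay.
  by exists [::]; split=> //; apply: eq_exist.
have [s [ws ls]] := IH Az Ay.
by exists (exist _ z Az :: s).
Qed.

Lemma reach_connected :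
  (exists x : G, True) -> (forall x y, reach setT x y) -> connected G.
Proof.
move=> ne reachG; split=> // x y.
have xy := clos_rt_rt1n _ _ _ _ (reachG x y).
elim: xy => {x y} [x|x z y [_ _ xz] _ [s [ws ls]]]; first by exists [::].
by exists (z :: s).
Qed.

Lemma reach_path A x y : A x -> reach A x y ->
  exists n (q : nat -> G), [/\ q 0 = x, q n = y,
    forall i, i <= n -> A (q i) & forall i, i < n -> adj (q i) (q i.+1)].
Proof.
move=> Ax h; have {h}xy := clos_rt_rt1n _ _ _ _ h; elim: xy Ax => {x y} [x|x z y [_ Az xz] _ IH] Ax.
  by exists 0, (fun=> x); split.
have [n [q [q0 qn Aq adjq]]] := IH Az.
exists n.+1, (fun i => if i is j.+1 then q j else x); split=> //.
- by case=> // i; apply: Aq.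
- by case=> [_|i]; [rewrite q0 | apply: adjq].
Qed.

Definition geodesic n (q : nat -> G) :=
  (forall i j, i < j <= n -> q i <> q j) /\
  (forall i j, i < j <= n -> adj (q i) (q j) -> j = i.+1).

Lemma reach_geodesic A x y : A x -> reach A x y ->
  exists n (q : nat -> G), [/\ q 0 = x, q n = y,
    forall i, i <= n -> A (q i), forall i, i < n -> adj (q i) (q i.+1)
    & geodesic n q].
Proof.
move=> Ax /(reach_path Ax) xy.
pose P n := `[< exists (q : nat -> G), [/\ q 0 = x, q n = y,
    forall i, i <= n -> A (q i) & forall i, i < n -> adj (q i) (q i.+1)] >].
have exP : exists n, P n by case: xy => n ?; exists n; apply/asboolP.
case: (ex_minnP exP) => n /asboolP[q [q0 qn Aq adjq]] min.
have shortcut i j : i < j <= n -> adj (q i) (q j) -> j = i.+1.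
  move=> /andP[ij jn] qij; apply/eqP; case: (eqVneq j i.+1) => // ji.
  (* Jumping along the edge from [q i] to [q j] saves [j - i.+1] steps. *)
  have /min : P (n - (j - i.+1)).
    apply/asboolP; exists (fun k => if k <= i then q k else q (k + (j - i.+1))).
    split=> //.
    - case: leqP => h; last by rewrite subnK //; lia.
      lia.
    - by move=> k kn; case: leqP => h; apply: Aq; lia.
    - move=> k kn; case: (ltngtP k i) => h.
      + by apply: adjq; lia.
      + by rewrite addSn; apply: adjq; lia.
      + by rewrite h addSn -addnS subnSK // subnKC // ltnW.
  lia.
exists n, q; split=> //; split=> // i j /andP[ij jn] qij.
(* For [j < n], the edge from [q j] to [q j.+1] is a shortcut starting at [i]; for [j = n], the walk
   can stop at [i]. *)
case: (ltngtP j n) => h.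
- have := shortcut i j.+1; rewrite qij h => /(_ _ (adjq _ h)).
  by move=> /(_ ltac:(lia)); lia.
- lia.
- have /min : P i.
    apply/asboolP; exists q; split=> //.
    + by rewrite qij h.
    + by move=> k ki; apply: Aq; lia.
    + by move=> k ki; apply: adjq; lia.
  lia.
Qed.

(* If two neighbours of [s] on an induced path have no neighbour of [s] between
   them, then the segment between them and [s] form an induced cycle. *)
Lemma chordal_geodesic (s : G) n (q : nat -> G) :
  chordal G -> geodesic n q -> (forall i, i < n -> adj (q i) (q i.+1)) ->
  (forall i, i <= n -> q i <> s) ->
  adj s (q 0) -> adj s (q n) -> forall i, i <= n -> adj s (q i).
Proof.
move=> chG [qinj qind] adjq qs s0 sn.
(* Induction on a bound for the length of a segment between two neighbours of [s]; an inner
   neighbour splits the segment. *)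
suff H m : forall a b, b - a <= m -> a <= b <= n -> adj s (q a) ->
    adj s (q b) -> forall i, a <= i <= b -> adj s (q i).
  by move=> i ni; apply: (H n 0 n) => //; lia.
elim: m => [|m IH] a b bam abn sa sb i aib.
  by have -> : i = a by lia.
have [[j [ajb sj]]|none] := pselect (exists j, a < j < b /\ adj s (q j)).
  case: (leqP i j) => ij.
    by apply: (IH a j) => //; lia.
  by apply: (IH j b) => //; lia.
have [->//|ia] := eqVneq i a.
have [->//|ib] := eqVneq i b.
have ab : a.+1 < b by lia.
(* The [b - a + 1] vertices of the segment, followed by [s]; the length is at least four because
   [a.+1 < b]. *)
pose N := (b - a).+2.
pose c (k : 'I_N) := if k <= b - a then q (a + k) else s.
have cval (k : 'I_N) : (k <= b - a /\ c k = q (a + k)) \/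
    (k = b - a + 1 :> nat /\ c k = s).
  by rewrite /c; case: leqP => h; [left|right; split=> //; have := ltn_ord k; lia].
have vS (k : 'I_N) : k <= b - a -> ordS k = k.+1 :> nat.
  by move=> h /=; rewrite modn_small //; rewrite /N; lia.
have vS' (k : 'I_N) : k = b - a + 1 :> nat -> ordS k = 0 :> nat.
  by move=> h /=; rewrite h addn1 modnn.
have cyc : is_cycle c.
  split; first by rewrite /N; lia.
  - move=> k l; case: (cval k) => -[hk ->]; case: (cval l) => -[hl ->] e.
    + apply/val_inj => /=; case: (ltngtP k l) => // h.
      * by case: (qinj (a + k) (a + l)) => //; lia.
      * by case: (qinj (a + l) (a + k)) => //; lia.
    + by case: (qs (a + k)) => //; lia.
    + by case: (qs (a + l)) => //; lia.
    + by apply/val_inj; rewrite /= hk hl.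
  - move=> k; case: (cval k) => -[hk ek]; case: (cval (ordS k)) => -[hl el];
      rewrite ek el.
    + by move: hl; rewrite (vS _ hk) addnS => hl; apply: adjq; lia.
    + move: hl; rewrite (vS _ hk) => hl.
      have -> : a + k = b by lia.
      exact: adj_sym.
    + by rewrite (vS' _ hk) addn0.
    + by move: hl; rewrite (vS' _ hk); lia.
(* The next three facts turn the condition [k != ordS l] on chords into arithmetic on positions. *)
have nS (k l : 'I_N) : k != ordS l -> k <= b - a -> l <= b - a ->
    k <> l.+1 :> nat.
  by move=> h _ hl e; case/eqP: h; apply/val_inj/(etrans e)/esym/vS.
have nS' (k l : 'I_N) : k != ordS l -> l = b - a + 1 :> nat -> k <> 0 :> nat.
  by move=> h hl e; case/eqP: h; apply/val_inj/(etrans e)/esym/vS'.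
have nS'' (k l : 'I_N) : k != ordS l -> l <= b - a -> k = b - a + 1 :> nat ->
    l <> b - a :> nat.
  by move=> h hl hk e; case/eqP: h; apply/val_inj/esym/(etrans (vS _ hl)); rewrite /= hk e addn1.
have [|k [l [akl lk kl]]] := chG N c _ cyc; first by rewrite /N; lia.
(* A chord within the segment contradicts [qind]; a chord at [s] gives an inner neighbour, against
   [none]. *)
case: (cval k) akl => -[hk ->]; case: (cval l) => -[hl ->] akl.
- case: (ltngtP k l) => h.
  + by have := nS _ _ lk hl hk; have := qind _ _ _ akl; lia.
  + by have := nS _ _ kl hk hl; have := qind _ _ _ (adj_sym akl); lia.
  + by move: akl; rewrite h => /adj_irr.
- case: none; exists (a + k); split; last exact: adj_sym.
  by have := nS' _ _ kl hl; have := nS'' _ _ lk hk hl; lia.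
- case: none; exists (a + l); split=> //.
  by have := nS' _ _ lk hk; have := nS'' _ _ kl hl hk; lia.
- by move/adj_irr: akl.
Qed.

End Reachability.

(** * Maximal cliques under local finiteness *)

Section Cliques.
Variable G : sgraph.
Hypothesis lfG : locally_finite G.
Implicit Types (S K L M : set G).

Lemma clique_sub S K : S `<=` K -> clique K -> clique S.
Proof. by move=> SK cK x y Sx Sy; apply: cK; apply: SK. Qed.

Lemma cliqueU S x : clique S -> (forall s, S s -> adj s x) -> clique (S `|` [set x]).
Proof.
move=> cS Sx y z [Sy|->] [Sz|->] // yz; try exact: cS; try exact: Sx.
by apply: adj_sym; apply: Sx.
Qed.

(* The cliques containing [v] are subsets of the finite closed neighbourhood
   of [v], so there is no infinite ascending chain of them. *)
Lemma clique_ind (v : G) (P : set G -> Prop) :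
  (forall S, clique S -> S v ->
     (forall S', clique S' -> S `<=` S' -> S' <> S -> P S') -> P S) ->
  forall S, clique S -> S v -> P S.
Proof.
move=> IH.
have : finite_set (v |` [set w | adj v w]).
  by rewrite finite_setU; split=> //; apply: lfG.
move=> /(@finite_seqP {classic G})[s sP].
(* [mu] drops when a clique containing [v] grows: a new vertex is in the list [s] and is no longer
   counted. *)
pose mu S := count (fun x : {classic G} => ~~ `[< S x >]) s.
move=> S; have [n] := ubnP (mu S); elim: n S => // n IHn S Sn cS Sv.
apply: IH => // S' cS' SS' S'S; apply: IHn => //; last exact: SS'.
have [x [S'x Sx]] : exists x, S' x /\ ~ S x.
  apply: contrapT => no; apply: S'S; apply/seteqP; split=> // x S'x.
  by apply: contrapT => Sx; apply: no; exists x.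
have xs : (x : {classic G}) \in s.
  suff : (v |` [set w | adj v w]) x by rewrite sP.
  have [->|xv] := pselect (x = v); first by left.
  right; apply: cS' => //; [exact: SS' | by move/esym].
apply: leq_trans (Sn : mu S <= n).
have /perm_to_rem sperm := xs.
rewrite /mu !(permP sperm) /= asboolT // asboolF //= add0n add1n ltnS; apply: sub_count => y /= /asboolP S'y.
by apply/asboolP => Sy; apply: S'y; apply: SS'.
Qed.

Lemma maximal_clique_above S : clique S -> (exists x, S x) ->
  exists K, maximal_clique K /\ S `<=` K.
Proof.
move=> cS [v Sv]; move: S cS Sv; apply: clique_ind => S cS Sv IH.
have [mS|] := pselect (maximal_clique S); first by exists S; split.
move=> /not_andP[//|/existsNP[L /not_implyP[cL /not_implyP[SL LS]]]].
have [K [mK LK]] := IH L cL SL LS.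
by exists K; split=> //; apply: subset_trans LK.
Qed.

Lemma maximal_clique_nonempty K : (exists x : G, True) -> maximal_clique K ->
  exists x, K x.
Proof.
move=> [v _] [cK maxK]; apply: contrapT => noK.
have K0 : K `<=` [set v] by move=> x Kx; case: noK; exists x.
have cv : clique [set v] by move=> x y -> ->.
by case: noK; exists v; rewrite -(maxK _ cv K0).
Qed.

End Cliques.

(** * Deck transformations and cliques *)

Section DeckGroup.
Variables (H G : sgraph) (p : H -> G).
Implicit Types (S K L M : set H) (f g : H -> H).

Lemma deck_id : deck p id.
Proof. by split=> //; split=> //; exists id. Qed.

Lemma deck_comp f g : deck p f -> deck p g -> deck p (f \o g).
Proof.
move=> [[bf af] pf] [[bg ag] pg]; split; last by move=> x; rewrite /= pf pg.
by split=> [|x y]; [exact: bij_comp | rewrite /= af ag].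
Qed.

Lemma deck_inv f : deck p f -> exists g, [/\ deck p g, cancel f g & cancel g f].
Proof.
move=> [[[g fK gK] af] pf]; exists g; split=> //; split; last first.
  by move=> x; rewrite -pf gK.
by split=> [|x y]; [exists f | rewrite -af !gK].
Qed.

Lemma deck_clique f K : deck p f -> clique K -> clique (f @` K).
Proof.
move=> [[_ af] _] cK _ _ [x Kx <-] [y Ky <-] xy; apply/af; apply: cK => //.
by move=> e; apply: xy; rewrite e.
Qed.

Lemma deck_maximal_clique f K :
  deck p f -> maximal_clique K -> maximal_clique (f @` K).
Proof.
move=> df [cK maxK]; split; first exact: deck_clique.
have [g [dg fK gK]] := deck_inv df.
move=> L cL KL; rewrite -(image_can L gK); congr image.
apply: maxK; first exact: deck_clique.
by rewrite -(image_can K fK); apply: image_subset.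
Qed.

Lemma deck_setI f K L : deck p f -> f @` (K `&` L) = f @` K `&` f @` L.
Proof.
move=> df; have [g [_ fK _]] := deck_inv df.
apply/seteqP; split; first by move=> _ [x [Kx Lx] <-]; split; exists x.
by move=> _ [[x Kx <-] [y Ly /(can_inj fK) e]]; exists x => //; rewrite -e in Kx *.
Qed.

(** * Freeness of the deck group and equivariant choice *)

Hypothesis covp : covering p.

(** The edges from [x] to [y] and from [x] to [z] have the same image, so they coincide. *)
Lemma covering_adj_inj (x y z : H) : adj x y -> adj x z -> p y = p z -> y = z.
Proof.
move=> xy xz pyz; case: covp => _ _ /(_ x) [_ inj _].
have e : [set x; y] = [set x; z].
  apply: inj; rewrite ?inE.
  - by split; [exists x, y | left].
  - by split; [exists x, z | left].
  - by rewrite !image_setU !image_set1 pyz.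
have : [set x; z] y by rewrite -e; right.
by case=> // yx; move: xy; rewrite yx => /adj_irr.
Qed.

Lemma covering_locally_finite : locally_finite G -> locally_finite H.
Proof.
(* [g] lifts a neighbour of [p v] to the neighbour of [v] above it; the default [v] occurs only
   where there is none. *)
move=> lfG v; pose g w := eps v [set y | adj v y /\ p y = w].
apply: (@sub_finite_set _ _ (g @` [set w | adj (p v) w])); last first.
  exact/finite_image/lfG.
move=> y /= vy; case: covp => _ homp _.
exists (p y); first exact: homp.
have [vg pg] : [set z | adj v z /\ p z = p y] (g (p y)) by apply: epsP; exists y.
exact: covering_adj_inj vg vy pg.
Qed.

Lemma clique_covering_inj K x y : clique K -> K x -> K y -> p x = p y -> x = y.
Proof.
move=> cK Kx Ky pxy; apply: contrapT => xy; case: covp => _ homp _.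
by have := homp _ _ (cK _ _ Kx Ky xy); rewrite pxy => /adj_irr.
Qed.

Hypothesis conH : connected H.

(** Unique lifting: agreement at a vertex passes to its neighbours by [covering_adj_inj], hence
    along walks. *)
Lemma deck_free f g x : deck p f -> deck p g -> f x = g x -> f = g.
Proof.
move=> [[_ af] pf] [[_ ag] pg] fgx; apply: funext => y.
have [s [ws <-]] := conH.2 x y.
elim: s x ws fgx => //= z s IH x [xz ws] fgx; apply: IH => //.
apply: (@covering_adj_inj (f x)); rewrite ?pf ?pg //; first exact/af.
by rewrite fgx; apply/ag.
Qed.

Lemma deck_clique_free f g S : deck p f -> deck p g ->
  clique S -> S !=set0 -> f @` S = g @` S -> f = g.
Proof.
move=> df dg cS [x Sx] fgS; apply: (@deck_free _ _ x) => //.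
apply: (@clique_covering_inj (f @` S)); first exact: deck_clique.
- by exists x.
- by rewrite fgS; exists x.
- by rewrite df.2 dg.2.
Qed.

(* The deck group acts freely on the nonempty cliques, so a choice made at one
   clique of each orbit extends uniquely to an equivariant choice. *)
Definition orbit_base S : set H :=
  eps set0 [set S' | exists f, deck p f /\ S' = f @` S].

Definition from_base S : H -> H := eps id [set f | deck p f /\ f @` orbit_base S = S].

Lemma orbit_baseP S : exists f, deck p f /\ orbit_base S = f @` S.
Proof.
apply: (@epsP _ set0 [set S' | exists f, deck p f /\ S' = f @` S]).
by exists S, id; split; [exact: deck_id | rewrite image_id].
Qed.

Lemma from_baseP S : deck p (from_base S) /\ from_base S @` orbit_base S = S.
Proof.
apply: (@epsP _ id [set f | deck p f /\ f @` orbit_base S = S]).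
have [f [df ->]] := orbit_baseP S; have [g [dg fK _]] := deck_inv df.
by exists g; split=> //; apply: image_can.
Qed.

Lemma orbit_base_deck f S : deck p f -> orbit_base (f @` S) = orbit_base S.
Proof.
move=> df; congr eps; apply/seteqP; split=> S' [h [dh ->]].
  by exists (h \o f); split; [exact: deck_comp | rewrite image_comp].
have [g [dg fK _]] := deck_inv df.
exists (h \o g); split; first exact: deck_comp.
by rewrite -(image_comp g h) (image_can _ fK).
Qed.

(** Both sides carry the base of the orbit to the translate of [S], and freeness makes such a
    transformation unique. *)
Lemma from_base_deck f S : deck p f -> clique S -> S !=set0 ->
  from_base (f @` S) = f \o from_base S.
Proof.
move=> df cS neS; have [dS bS] := from_baseP S.
have [dfS bfS] := from_baseP (f @` S).
have [h [dh bE]] := orbit_baseP S.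
apply: (@deck_clique_free _ _ (orbit_base S)) => //.
- exact: deck_comp.
- by rewrite bE; apply: deck_clique.
- by rewrite bE; apply: image_nonempty.
- by rewrite -{1}(orbit_base_deck S df) bfS -image_comp bS.
Qed.

(** [A] is pulled back to the base of the orbit, the choice is made there and carried to [S]. For a
    nonempty clique [S], translating [S] and [A] together leaves the pulled-back family
    unchanged. *)
Definition pick_at S (A : set (set H)) : set H :=
  from_base S @` eps set0 [set M | A (from_base S @` M)].

Lemma pick_atP S A : A !=set0 -> A (pick_at S A).
Proof.
move=> [K AK]; apply: (@epsP _ set0 [set M | A (from_base S @` M)]).
have [g [_ _ gK]] := deck_inv (from_baseP S).1.
by exists (g @` K); rewrite /= (image_can _ gK).
Qed.

Lemma pick_at_deck f S (A B : set (set H)) :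
  deck p f -> clique S -> S !=set0 -> (forall M, B (f @` M) <-> A M) ->
  pick_at (f @` S) B = f @` pick_at S A.
Proof.
move=> df cS neS AB; rewrite /pick_at from_base_deck // -image_comp.
congr (f @` (_ @` (eps _ _))); apply/seteqP; split=> M /=.
  by rewrite -image_comp AB.
by rewrite -image_comp AB.
Qed.

(** * Classes of maximal cliques connected outside a set *)

Definition link S : set H -> set H -> Prop :=
  clos_refl_trans (set H) (fun M N =>
    [/\ maximal_clique M, maximal_clique N & exists x, [/\ M x, N x & ~ S x]]).

Lemma link_trans S K L M : link S K L -> link S L M -> link S K M.
Proof. exact: rt_trans. Qed.

Lemma link_sym S K L : link S K L -> link S L K.
Proof.
elim=> [{}K {}L [mK mL [x [Kx Lx Sx]]]|{}K|{}K M {}L _ MK _ LM].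
- by apply: rt_step; split=> //; exists x.
- exact: rt_refl.
- exact: link_trans MK.
Qed.

Lemma link_image f S K L :
  deck p f -> link S K L -> link (f @` S) (f @` K) (f @` L).
Proof.
move=> df; have [g [_ fK _]] := deck_inv df.
elim=> [{}K {}L [mK mL [x [Kx Lx Sx]]]|{}K|{}K M {}L _ MK _ LM].
- apply: rt_step; split; try exact: deck_maximal_clique.
  exists (f x); split; [by exists x|by exists x|].
  by move=> [y Sy /(can_inj fK) e]; apply: Sx; rewrite -e.
- exact: rt_refl.
- exact: link_trans LM.
Qed.

Lemma link_deck f S K L :
  deck p f -> link (f @` S) (f @` K) (f @` L) <-> link S K L.
Proof.
move=> df; split; last exact: link_image.
have [g [dg fK _]] := deck_inv df.
by move=> /(link_image dg); rewrite !(image_can _ fK).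
Qed.

Lemma sub_deck f S K : deck p f -> f @` S `<=` f @` K <-> S `<=` K.
Proof.
move=> df; split; last exact: image_subset.
have [g [dg fK _]] := deck_inv df.
by move=> /(@image_subset _ _ g); rewrite !(image_can _ fK).
Qed.

Lemma maximal_clique_deck f K :
  deck p f -> maximal_clique (f @` K) <-> maximal_clique K.
Proof.
move=> df; split; last exact: deck_maximal_clique.
have [g [dg fK _]] := deck_inv df.
by move=> /(deck_maximal_clique dg); rewrite (image_can _ fK).
Qed.

(** * The stars, chosen equivariantly *)

Definition root S : set H :=
  pick_at S [set M | maximal_clique M /\ S `<=` M].

(** [K] enters only through its class under [link S], so a class has a single representative. *)
Definition rep S K : set H :=
  pick_at S [set M | [/\ maximal_clique M, S `<=` M & link S K M]].

Lemma root_deck f S : deck p f -> clique S -> S !=set0 ->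
  root (f @` S) = f @` root S.
Proof.
move=> df cS neS; apply: pick_at_deck => // M /=.
by rewrite maximal_clique_deck // sub_deck.
Qed.

Lemma rep_deck f S K : deck p f -> clique S -> S !=set0 ->
  rep (f @` S) (f @` K) = f @` rep S K.
Proof.
move=> df cS neS; apply: pick_at_deck => // M /=.
by split=> -[mM SM KM]; split; move: mM SM KM;
  rewrite ?maximal_clique_deck ?sub_deck ?link_deck.
Qed.

Lemma repP S K : maximal_clique K -> S `<=` K ->
  [/\ maximal_clique (rep S K), S `<=` rep S K & link S K (rep S K)].
Proof.
move=> mK SK.
apply: (@pick_atP S [set M | [/\ maximal_clique M, S `<=` M & link S K M]]).
by exists K; split=> //; apply: rt_refl.
Qed.

Lemma rep_link S K L : link S K L -> rep S K = rep S L.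
Proof.
move=> KL; congr pick_at; apply/seteqP; split=> M /= [mM SM lM]; split=> //.
  exact/(link_trans _ lM)/link_sym.
exact: link_trans lM.
Qed.

(* For every [S], the edges with intersection [S] form a star whose centre
   [root S] is joined to one clique in each of the other classes of [link S]
   among the maximal cliques containing [S]. *)
Definition clique_tree_adj K L :=
  [/\ K `&` L !=set0, ~ link (K `&` L) K L &
    (K = root (K `&` L) /\ L = rep (K `&` L) L) \/
    (L = root (K `&` L) /\ K = rep (K `&` L) K)].

Lemma clique_tree_adj_sym K L : clique_tree_adj K L -> clique_tree_adj L K.
Proof.
move=> [ne nl e]; rewrite /clique_tree_adj setIC; split=> //; last by case: e; tauto.
by move/link_sym.
Qed.

(** * The clique tree has no cycles *)

Definition mclique := {K : set H | maximal_clique K}.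

Lemma clique_tree_sym (K L : mclique) :
  clique_tree_adj (sval K) (sval L) -> clique_tree_adj (sval L) (sval K).
Proof. exact: clique_tree_adj_sym. Qed.

Lemma clique_tree_irr (K : mclique) : ~ clique_tree_adj (sval K) (sval K).
Proof. by case=> _ + _; apply; apply: rt_refl. Qed.

Definition clique_tree : sgraph := SGraph clique_tree_sym clique_tree_irr.

Lemma clique_tree_adj_deck f K L : deck p f -> maximal_clique K ->
  clique_tree_adj K L -> clique_tree_adj (f @` K) (f @` L).
Proof.
move=> df [cK _] [ne nl e].
have cS : clique (K `&` L) by apply: clique_sub cK; apply: subIsetl.
rewrite /clique_tree_adj -deck_setI //; split.
- exact: image_nonempty.
- by rewrite link_deck.
- rewrite root_deck // !rep_deck //.
  by case: e => -[e1 e2]; [left|right]; rewrite -e1 -e2.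
Qed.

(** The [q i] will be the rest of a cycle through an edge with minimal intersection [S]; they need
    not contain [S]. A step with another intersection has a common vertex outside [S], so it is a
    link. The first step with intersection [S] would have to join [q 0] directly to the root [q k],
    which [1 < k] prevents. *)
Lemma clique_tree_star S (q : nat -> set H) k : 1 < k ->
  (forall i j, i <= k -> j <= k -> q i = q j -> i = j) ->
  (forall i, i <= k -> maximal_clique (q i)) ->
  (forall i, i < k -> clique_tree_adj (q i) (q i.+1)) ->
  (forall i, i < k -> q i `&` q i.+1 `<=` S -> q i `&` q i.+1 = S) ->
  q 0 = rep S (q 0) -> q k = root S -> link S (q 0) (root S).
Proof.
move=> k1 qinj mq qadj minS q0 qk; apply: contrapT => nl.
suff : forall i, i <= k -> link S (q 0) (q i).
  by move=> /(_ k (leqnn k)); rewrite qk.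
elim=> [|i IH] ik; first by rewrite /link; apply: rt_refl.
have {}IH := IH (ltnW ik).
have [e|ne] := pselect (q i `&` q i.+1 = S); last first.
  apply: link_trans IH _; apply: rt_step; split; [exact/mq/ltnW|exact: mq|].
  apply: contrapT => no; apply: ne; apply: minS => // x [ix iSx].
  by apply: contrapT => Sx; apply: no; exists x.
have [_ _] := qadj _ ik; rewrite e => -[[er _]|[er ei]].
  by case: nl; rewrite -er.
(* [q i] represents its class, which is that of [q 0], and [q 0] is the representative of that
   class. *)
have i0 : i = 0 by apply: qinj; rewrite // 1?ltnW // ei -(rep_link IH) -q0.
by move: er; rewrite -qk i0 => /qinj => /(_ (ltnW k1) (leqnn k)) k1'; rewrite -k1' in k1.
Qed.

Lemma iter_ordS n (i : 'I_n) t : iter t (@ordS n) i = (i + t) %% n :> nat.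
Proof.
elim: t => [|t IH]; first by rewrite addn0 modn_small.
by rewrite iterS /= IH -addn1 modnDml addn1 addnS.
Qed.

Lemma clique_tree_acyclic n (c : 'I_n -> clique_tree) : ~ is_cycle c.
Proof.
move=> [n3 cinj cadj].
pose K i := sval (c i); pose sep i := K i `&` K (ordS i).
have Kinj : injective K.
  move=> i j; rewrite /K => e; apply: cinj.
  by case: (c i) (c j) e => [? ?] [? ?] /= e; apply: eq_exist.
have i0 : 'I_n by exists 0; lia.
(* Minimising the number of intersections contained in [sep i] yields an inclusion-minimal one. *)
pose mu (i : 'I_n) := #|[set j | `[< sep j `<=` sep i >]]%SET|.
case: (@arg_minnP _ i0 xpredT mu erefl) => {i0} i _ min.
have minS j : sep j `<=` sep i -> sep j = sep i.
  move=> ji; apply/seteqP; split=> //; apply: contrapT => ij.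
  have := min j erefl; rewrite leqNgt => /negP; apply.
  apply/proper_card/properP; split.
    apply/fintype.subsetP => l; rewrite !finset.in_set => /asboolP lj; apply/asboolP.
    by move=> x /lj/ji.
  by exists i; rewrite finset.in_set; apply/asboolP.
(* [q] goes the long way round the cycle, from the successor of [i] to [i] in [n.-1] steps. *)
pose q t := K (iter t (@ordS n) (ordS i)).
have qn : q n.-1 = K i.
  rewrite /q -iterSr prednK; last by lia.
  by congr K; apply/val_inj; rewrite /= iter_ordS modnDr modn_small.
have qinj s t : s <= n.-1 -> t <= n.-1 -> q s = q t -> s = t.
  move=> sn tn /Kinj/(congr1 val); rewrite /= !iter_ordS => /eqP.
  by rewrite eqn_modDl !modn_small; [move/eqP | lia..].
have qadj t : clique_tree_adj (q t) (q t.+1) by apply: cadj.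
have qmin t : q t `&` q t.+1 `<=` sep i -> q t `&` q t.+1 = sep i by apply: minS.
have mq t : maximal_clique (q t) by apply: proj2_sig.
have n1 : 1 < n.-1 by lia.
have [_ nl [[er ep]|[er ep]]] := cadj i.
- apply: nl; rewrite {2}er; apply: link_sym.
  by apply: (clique_tree_star n1 qinj (fun t _ => mq t) (fun t _ => qadj t)
    (fun t _ => @qmin t) ep); rewrite qn.
(* Here the root sits at the successor of [i], so the path is read backwards. *)
- apply: nl; rewrite {2}er.
  have := @clique_tree_star (sep i) (fun t => q (n.-1 - t)) n.-1.
  rewrite subn0 subnn qn; apply=> //.
  + by move=> s t sn tn /qinj e; have := e ltac:(lia) ltac:(lia); lia.
  + move=> t tn; apply: clique_tree_adj_sym.
    by have -> : n.-1 - t = (n.-1 - t.+1).+1 by lia.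
  + move=> t tn; rewrite setIC.
    have -> : n.-1 - t = (n.-1 - t.+1).+1 by lia.
    exact: qmin.
Qed.

(** Successive shared vertices form a walk outside [S]. The case [K = L] stands apart because a
    trivial chain provides no vertex outside [S]. *)
Lemma link_reach S K L : link S K L -> K = L \/
  exists x y, [/\ K x, ~ S x, L y, ~ S y & reach (~` S) x y].
Proof.
move=> h; have {h}KL := clos_rt_rt1n _ _ _ _ h.
elim: KL => {K L} [K|K M L [mK mM [x [Kx Mx Sx]]] _ IH]; first by left.
right; case: IH => [<-|[y [z [My Sy Lz Sz yz]]]].
  by exists x, x; split=> //; apply: rt_refl.
exists x, z; split=> //; have [->//|xy] := pselect (x = y).
by apply: reach_trans yz; apply: reach_step => //; apply: mM.1.
Qed.

(** * Connectedness of the clique tree from chordality *)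

Hypotheses (lfH : locally_finite H) (chH : chordal H).

Lemma clique_tree_reach S : clique S -> S !=set0 -> forall K L : clique_tree,
  S `<=` sval K -> S `<=` sval L ->
  reach [set M : clique_tree | S `<=` sval M] K L.
Proof.
move=> cS [v Sv]; move: S cS Sv; apply: (@clique_ind _ lfH v) => S cS Sv IH.
(* The intersection of [K] and [L] is a clique strictly larger than [S], so the induction hypothesis
   joins them. *)
have near (K L : clique_tree) x : S `<=` sval K -> S `<=` sval L ->
    ~ S x -> sval K x -> sval L x ->
    reach [set M : clique_tree | S `<=` sval M] K L.
  move=> SK SL Sx Kx Lx.
  have SKL : S `<=` sval K `&` sval L by move=> y Sy; split; [exact: SK|exact: SL].
  apply: (@reach_sub _ [set M : clique_tree | sval K `&` sval L `<=` sval M]).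
    by move=> M; apply: subset_trans SKL.
  apply: IH => //.
  - by apply: clique_sub (proj2_sig K).1; apply: subIsetl.
  - by move=> e; apply: Sx; rewrite -e.
have linked (K L : clique_tree) : S `<=` sval K -> S `<=` sval L ->
    link S (sval K) (sval L) -> reach [set M : clique_tree | S `<=` sval M] K L.
  move=> SK SL KL; case: (link_reach KL) => [|[x [y [Kx Sx Ly Sy]]]] {KL}.
    by case: K L SK SL => [K mK] [L mL] /= _ _ e; rewrite (eq_exist _ _ e); apply: rt_refl.
  move=> /(reach_geodesic (Sx : (~` S) x))[n [q [q0 qn Sq adjq geo]]].
  (* By chordality the whole geodesic stays in the common neighbourhood of [S], so [S] with any edge
     of it is a clique. *)
  have adjS s i : S s -> i <= n -> adj s (q i).
    move=> Ss; apply: (chordal_geodesic chH geo) => //.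
    - by move=> j jn e; apply: (Sq j jn); rewrite e.
    - apply: (proj2_sig K).1; [exact: SK|by rewrite q0|].
      by move=> e; apply: (Sq 0) => //; rewrite -e.
    - apply: (proj2_sig L).1; [exact: SL|by rewrite qn|].
      by move=> e; apply: (Sq n) => //; rewrite -e.
  have cq i : i <= n -> clique (S `|` [set q i]).
    by move=> ni; apply: cliqueU => // s Ss; apply: adjS.
  suff : forall i (M : clique_tree), i <= n -> S `<=` sval M -> sval M (q i) ->
      reach [set M : clique_tree | S `<=` sval M] K M.
    by move=> /(_ n L); apply; rewrite ?qn.
  elim=> [|i IHi] M ni SM Mq.
    by apply: (near _ _ (q 0)) => //; [exact: Sq|rewrite q0].
  (* A maximal clique [N] above [S], [q i] and [q i.+1] is the bridge: it is reached through [q i]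
     and left by [near] through [q i.+1]. *)
  have cSq : clique (S `|` [set q i] `|` [set q i.+1]).
    apply: cliqueU; first exact/cq/ltnW.
    by move=> s [Ss|->]; [exact: adjS|exact: adjq].
  have [|N [mN SN]] := maximal_clique_above lfH cSq; first by exists v; left; left.
  pose N' : clique_tree := exist _ N mN.
  have SN' : S `<=` sval N' by move=> z Sz; apply: SN; left; left.
  apply: (@reach_trans _ _ N').
    by apply: IHi => //; [exact: ltnW|apply: SN; left; right].
  by apply: (near _ _ (q i.+1)) => //; [exact: Sq|apply: SN; right].
have [mR SR] : maximal_clique (root S) /\ S `<=` root S.
  apply: (@pick_atP S [set M | maximal_clique M /\ S `<=` M]).
  by apply: maximal_clique_above => //; exists v.
pose R : clique_tree := exist _ (root S) mR.
(* It suffices to reach the centre of the star: inside its own class by [linked], otherwise through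
   the representative of the class of [K] and one edge of the star. *)
suff toR (K : clique_tree) : S `<=` sval K ->
    reach [set M : clique_tree | S `<=` sval M] K R.
  move=> K L SK SL; apply: reach_trans (toR K SK) _.
  exact/reach_sym/toR.
move=> SK; have [mM SM KM] := repP (proj2_sig K) SK.
have [KR|KR] := pselect (link S (sval K) (root S)); first exact: linked.
pose M : clique_tree := exist _ (rep S (sval K)) mM.
apply: (@reach_trans _ _ M); first exact: linked.
apply: reach_step => //=.
have MR : ~ link S (rep S (sval K)) (root S) by move=> /(link_trans KM).
(* A common vertex outside [S] would link the representative to the root. *)
have e : rep S (sval K) `&` root S = S.
  apply/seteqP; split; last by move=> x Sx; split; [exact: SM|exact: SR].
  move=> x [Mx Rx]; apply: contrapT => Sx; apply: MR; apply: rt_step; split=> //.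
  by exists x.
rewrite /clique_tree_adj e; split=> //; first by exists v.
by right; split=> //; apply: rep_link.
Qed.

(** Cliques sharing a vertex are joined by the case of a singleton [S]; a walk in [H] chains such
    joins, each of its edges lying in a maximal clique. *)
Lemma clique_tree_connected : connected clique_tree.
Proof.
have clique1 (x : H) : clique [set x] by move=> y z -> ->.
apply: reach_connected.
  have [[x _] _] := conH.
  have [|K [mK _]] := maximal_clique_above lfH (clique1 x); first by exists x.
  by exists (exist _ K mK).
have common (K L : clique_tree) x : sval K x -> sval L x -> reach setT K L.
  move=> Kx Lx; apply: (@reach_sub _ [set M : clique_tree | [set x] `<=` sval M]) => //.
  by apply: clique_tree_reach; [exact: clique1|exists x|move=> y ->..].
move=> K L.
have [x Kx] := maximal_clique_nonempty conH.1 (proj2_sig K).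
have [y Ly] := maximal_clique_nonempty conH.1 (proj2_sig L).
have [s [ws ls]] := conH.2 x y.
elim: s x K Kx ws ls => [|z s IH] x K Kx /= => [_ e|[xz ws] ls].
  by apply: (common K L x) => //; rewrite e.
have cxz : clique ([set x] `|` [set z]) by apply: cliqueU => // _ ->.
have [|M [mM xzM]] := maximal_clique_above lfH cxz; first by exists x; left.
apply: (@reach_trans _ _ (exist _ M mM : clique_tree)).
  by apply: (common _ _ x) => //; apply: xzM; left.
by apply: IH ws ls; apply: xzM; right.
Qed.

(** * The tree-decomposition and the deck action on it *)

Lemma clique_tree_decomposition : tree_decomposition (sval : clique_tree -> set H).
Proof.
have clique1 (x : H) : clique [set x] by move=> y z -> ->.
have covers (v : H) : exists t : clique_tree, sval t v.
  have [|K [mK vK]] := maximal_clique_above lfH (clique1 v); first by exists v.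
  by exists (exist _ K mK); apply: vK.
split=> //.
- by split; [exact: clique_tree_connected | exact: clique_tree_acyclic].
- move=> x y xy.
  have cxy : clique ([set x] `|` [set y]) by apply: cliqueU => // _ ->.
  have [|K [mK xyK]] := maximal_clique_above lfH cxy; first by exists x; left.
  by exists (exist _ K mK); split; apply: xyK; [left|right].
- move=> v; apply: connected_induced => [|K L Kv Lv]; first exact: covers.
  apply: (@reach_sub _ [set M : clique_tree | [set v] `<=` sval M]).
    by move=> M; apply.
  by apply: clique_tree_reach; [exact: clique1|exists v|move=> y ->..].
Qed.

(** An action takes every map [H -> H] as argument, so it is extended by the identity off
    [deck p]. *)
Definition deck_act f (K : mclique) : mclique :=
  if pselect (deck p f) is left df
  then exist _ (f @` sval K) (deck_maximal_clique df (proj2_sig K)) else K.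

Lemma deck_actE f (K : mclique) : deck p f -> sval (deck_act f K) = f @` sval K.
Proof. by rewrite /deck_act => df; case: pselect. Qed.

Lemma mclique_inj : injective (sval : mclique -> set H).
Proof. by move=> [K mK] [L mL] /= e; apply: eq_exist. Qed.

Lemma clique_tree_canonical :
  canonical_decomposition (sval : clique_tree -> set H) (deck p).
Proof.
exists deck_act; split.
- move=> f df; have [g [dg fK gK]] := deck_inv df; split.
    by exists (deck_act g) => K; apply: mclique_inj;
      rewrite !deck_actE // ?(image_can _ fK) ?(image_can _ gK).
  move=> K L; rewrite /= !deck_actE //; split; last first.
    by apply: clique_tree_adj_deck => //; apply: proj2_sig.
  move=> /(clique_tree_adj_deck dg (deck_maximal_clique df (proj2_sig K))).
  by rewrite !(image_can _ fK).
- by move=> K; apply: mclique_inj; rewrite deck_actE ?image_id //; apply: deck_id.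
- move=> f g df dg K; apply: mclique_inj.
  rewrite !deck_actE ?image_comp //; exact: deck_comp.
- by move=> f df K; apply: deck_actE.
Qed.

Lemma clique_tree_bij : into_maximal_cliques (sval : clique_tree -> set H).
Proof.
split; first by move=> K _; apply: proj2_sig.
- by move=> K L _ _; apply: mclique_inj.
- by move=> K mK; exists (exist _ K mK).
Qed.

End DeckGroup.

Theorem theorem3 (G H : sgraph) (p : H -> G) :
  locally_finite G -> connected G ->
  normal_covering p -> connected H ->
  chordal H ->
  exists (T : sgraph) (bag : T -> set H),
    [/\ tree_decomposition bag,
        canonical_decomposition bag (deck p)
      & into_maximal_cliques bag].
Proof.
move=> lfG _ [covp _] conH chH.
have lfH := covering_locally_finite covp lfG.
exists (clique_tree p), sval; split.
- exact: clique_tree_decomposition.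
- exact: clique_tree_canonical.
- exact: clique_tree_bij.
Qed.
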